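(* For any $\varepsilon_{\mathtt{RM}}\in(0,1/4]$ and $N\lesssim\frac{1}{\varepsilon_{\mathtt{RM}}}$, there exist a problem instance $(\pi_{\mathsf{ref}},\hat r,r^\star)$ with $R_{\max}=1$ and $\varepsilon_{\mathtt{RM}}(x)\le\varepsilon_{\mathtt{RM}}$, and a comparator policy $\pi^\star$ with $\mathcal C^{\pi^\star}(x)=\mathcal C^{\pi^\star}=\widetilde O(1)$, such that any algorithm $\mathcal A$ using at most $N$ sample-and-evaluate queries must have $$J(\pi^\star;x)-J(\hat\pi_{\mathcal A};x)\ =\ \widetilde\Omega\Big(\frac1N\Big).$$
   Context: A problem instance is a tuple $(\pi_{\mathsf{ref}},\hat r,r^\star)$ of a base policy $\pi_{\mathsf{ref}}:\mathcal X\to\Delta(\mathcal Y)$, a reward model $\hat r$ and a true reward function $r^\star$, both functions $\mathcal X\times\mathcal Y\to[0,R_{\max}]$, where $\mathcal X$ is a prompt space and $\mathcal Y$ a response space; $x\in\mathcal X$ is the given prompt. Write $J(\pi;x)=\mathbb E_{y\sim\pi(\cdot\mid x)}[r^\star(x,y)]$, $\varepsilon_{\mathtt{RM}}^2(x)=\mathbb E_{y\sim\pi_{\mathsf{ref}}(\cdot\mid x)}[(\hat r(x,y)-r^\star(x,y))^2]$, and $\mathcal C^{\pi}(x)=\mathbb E_{y\sim\pi(\cdot\mid x)}\big[\frac{\pi(y\mid x)}{\pi_{\mathsf{ref}}(y\mid x)}\big]$; $\mathcal C^{\pi^\star}$ without argument denotes the prompt-independent value of $\mathcal C^{\pi^\star}(x)$.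 Sample-and-evaluate framework: the algorithm has no explicit access to $\pi_{\mathsf{ref}}$ or $\hat r$; instead, for a given prompt $x$, it can sample $N$ responses $y_1,\dots,y_N\sim\pi_{\mathsf{ref}}(\cdot\mid x)$ and observe the likelihood $\pi_{\mathsf{ref}}(y_i\mid x)$ and the reward model value $\hat r(x,y_i)$ for each such response; its efficiency is measured by the total number of queries $N$. The algorithm outputs a (possibly random) response, and $\hat\pi_{\mathcal A}(\cdot\mid x)$ is the distribution of its output. Notation: $f\lesssim g$ means $f=O(g)$; $f=\widetilde O(g)$ means $f=O(g\cdot\max\{1,\mathrm{polylog}(g)\})$, and $\widetilde\Omega$ is the corresponding lower-bound notation.
   Formalization: As stated, the algorithm that always outputs from π* is a counterexample; so the bound is proved on one fixed instance for algorithms that treat all unsampled responses alike, and for any other algorithm on a renaming of that instance's responses that may depend on the algorithm. *)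

(* Defs.v *)
From HB Require Import structures.
From mathcomp Require Import all_boot all_order all_algebra all_fingroup.
From mathcomp Require Import reals ereal exp.

Set Implicit Arguments.
Unset Strict Implicit.
Unset Printing Implicit Defensive.

Import Order.TTheory GRing.Theory Num.Theory.

Local Open Scope ring_scope.

Record dist (R : realType) (Y : finType) := Dist {
  mass :> Y -> R;
  mass_ge0 : forall y, 0 <= mass y;
  mass_sum1 : \sum_y mass y = 1
}.

Definition expect (R : realType) (Y : finType) (p : dist R Y) (f : Y -> R) : R :=
  \sum_y p y * f y.

Definition policy (R : realType) (X : Type) (Y : finType) := X -> dist R Y.

Record instance (R : realType) (X : Type) (Y : finType) (Rmax : R) := Instance {
  pi_ref : policy R X Y;
  r_hat : X -> Y -> R;
  r_star : X -> Y -> R;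
  r_hat_range : forall x y, 0 <= r_hat x y <= Rmax;
  r_star_range : forall x y, 0 <= r_star x y <= Rmax
}.

Definition J (R : realType) (X : Type) (Y : finType) (Rmax : R)
    (I : instance X Y Rmax) (pi : policy R X Y) (x : X) : R :=
  expect (pi x) (r_star I x).

Definition eps_RM (R : realType) (X : Type) (Y : finType) (Rmax : R)
    (I : instance X Y Rmax) (x : X) : R :=
  Num.sqrt (expect (pi_ref I x) (fun y => (r_hat I x y - r_star I x y) ^+ 2)).

(* Extended-real division has 0^-1 = +oo and 0 * +oo = 0, so the coverage is +oo
   exactly when [pi x] charges a response that [pi_ref I x] does not. *)
Definition coverage (R : realType) (X : Type) (Y : finType) (Rmax : R)
    (I : instance X Y Rmax) (pi : policy R X Y) (x : X) : \bar R :=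
  (\sum_y (pi x y)%:E * ((pi x y)%:E / (pi_ref I x y)%:E))%E.

(* One entry ((y_i, pi_ref(y_i | x)), r_hat(x, y_i)) for each of the n queries. *)
Definition transcript (R : realType) (Y : finType) (n : nat) :=
  {ffun 'I_n -> Y * R * R}.

Definition record_queries (R : realType) (X : Type) (Y : finType) (Rmax : R)
    (I : instance X Y Rmax) (x : X) (n : nat) (ys : {ffun 'I_n -> Y}) :
    transcript R Y n :=
  [ffun i => (ys i, pi_ref I x (ys i), r_hat I x (ys i))].

(* A randomized algorithm making n queries, given by the conditional law of its
   output given the transcript.  The output may be any response. *)
Definition algorithm (R : realType) (X : Type) (Y : finType) (n : nat) :=
  X -> transcript R Y n -> dist R Y.

Section Output.
Context (R : realType) (X : Type) (Y : finType) (Rmax : R).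
Variables (I : instance X Y Rmax) (n : nat) (A : algorithm R X Y n) (x : X).

Definition output_mass (y : Y) : R :=
  \sum_(ys : {ffun 'I_n -> Y})
     (\prod_i pi_ref I x (ys i)) * A x (record_queries I x ys) y.

Lemma output_mass_ge0 y : 0 <= output_mass y.
Proof.
apply: sumr_ge0 => ys _; apply: mulr_ge0; last exact: mass_ge0.
by apply: prodr_ge0 => i _; exact: mass_ge0.
Qed.

Lemma output_mass_sum1 : \sum_y output_mass y = 1.
Proof.
rewrite exchange_big /=.
under eq_bigr => ys _ do rewrite -mulr_sumr mass_sum1 mulr1.
by rewrite -(bigA_distr_bigA (fun _ => pi_ref I x)) big1 // => i _;
  exact: mass_sum1.
Qed.

Definition output_policy_at : dist R Y := Dist output_mass_ge0 output_mass_sum1.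

End Output.

Definition output_policy (R : realType) (X : Type) (Y : finType) (Rmax : R)
    (I : instance X Y Rmax) (n : nat) (A : algorithm R X Y n) : policy R X Y :=
  output_policy_at I A.

(* An algorithm with no knowledge of [pi_ref] and [r_hat] beyond its queries has
   nothing to tell apart two responses that no query returned.  Every algorithm
   that always outputs one of the y_i satisfies this; the algorithm which ignores
   its queries and outputs a prescribed response does not. *)
Definition oblivious (R : realType) (X : Type) (Y : finType) (n : nat)
    (A : algorithm R X Y n) : Prop :=
  forall (x : X) (t : transcript R Y n) (y y' : Y),
    (forall i, (t i).1.1 != y) -> (forall i, (t i).1.1 != y') ->
    A x t y = A x t y'.

(* Renaming y to s y.  An algorithm that is not oblivious may have one instance
   built into its output, so it can only be judged up to such a renaming; eps_RM,
   the coverage and J are unchanged when instance and policy are renamed together. *)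
Section Relabel.
Context (R : realType) (X : Type) (Y : finType) (Rmax : R).
Variable (s : {perm Y}).

Lemma relabel_sum1 (p : dist R Y) : \sum_y p ((s^-1)%g y) = 1.
Proof.
rewrite (reindex_inj (@perm_inj _ s)) /=.
by under eq_bigr => y _ do rewrite permK; exact: mass_sum1.
Qed.

Definition relabel_dist (p : dist R Y) : dist R Y :=
  Dist (fun y => mass_ge0 p ((s^-1)%g y)) (relabel_sum1 p).

Definition relabel_policy (pi : policy R X Y) : policy R X Y :=
  fun x => relabel_dist (pi x).

Definition relabel (I : instance X Y Rmax) : instance X Y Rmax :=
  Instance (relabel_policy (pi_ref I))
    (fun x y => r_hat_range I x ((s^-1)%g y))
    (fun x y => r_star_range I x ((s^-1)%g y)).

End Relabel.

(* f = O~(g) is f = O(g * max(1, polylog g)); C and k are the implied constant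
   and the degree of the polylogarithm. *)
Definition log_factor (R : realType) (k : nat) (g : R) : R :=
  Num.max 1 (`|ln g| ^+ k).

Definition Otilde_bound (R : realType) (C : R) (k : nat) (g : R) : R :=
  C * (g * log_factor k g).

Definition Omegatilde_bound (R : realType) (c : R) (k : nat) (g : R) : R :=
  c * (g / log_factor k g).

(* Main.v *)
(** The reference policy charges only a base response of reward 0 and, with
    probability d^2, a response g of reward 1; all the other responses are decoys
    of reward 0.  The comparator plays g with probability d, so it earns d, while
    its coverage is at most 1 + d^2/d^2 = 2.  Among n <= N queries g appears with
    probability at most N d^2; otherwise the transcript shows only the base
    response, and some one of the 8N remaining responses is output with
    probability at most 1/(8N).  Up to renaming, or because the algorithm is
    oblivious, that response is g.  With d = 1/(2N) the gap is at least
    1/(2N) - 1/(4N) - 1/(8N) = 1/(8N).  The reward model is exact. *)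
Require Import Defs.
From HB Require Import structures.
From mathcomp Require Import all_boot all_order all_algebra all_fingroup.
From mathcomp Require Import reals ereal exp.
From mathcomp Require Import ring lra.

Set Implicit Arguments.
Unset Strict Implicit.
Unset Printing Implicit Defensive.

Import Order.TTheory GRing.Theory Num.Theory.

Local Open Scope ring_scope.

Section TwoPoint.
Context (R : realType) (Y : finType).

Definition two_point_mass (q : R) (a b y : Y) : R :=
  (1 - q) * (y == a)%:R + q * (y == b)%:R.

Lemma sum_indic (f : Y -> R) (a : Y) : \sum_y f y * (y == a)%:R = f a.
Proof.
rewrite (bigD1 a) //= eqxx mulr1 big1 ?addr0 // => y /negbTE ->.
by rewrite mulr0.
Qed.

Lemma two_point_ge0 (q : R) (a b : Y) (q01 : 0 <= q <= 1) y :
  0 <= two_point_mass q a b y.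
Proof.
by case/andP: q01 => q0 q1; rewrite addr_ge0 // mulr_ge0 // subr_ge0.
Qed.

Lemma two_point_sum1 (q : R) (a b : Y) : \sum_y two_point_mass q a b y = 1.
Proof.
rewrite big_split /= (sum_indic (fun=> 1 - q)) (sum_indic (fun=> q)).
exact: subrK.
Qed.

Definition two_point (q : R) (a b : Y) (q01 : 0 <= q <= 1) : dist R Y :=
  Dist (two_point_ge0 a b q01) (two_point_sum1 q a b).

End TwoPoint.

Lemma bernoulli_le (R : realType) (q : R) (n : nat) :
  0 <= q <= 1 -> 1 - n%:R * q <= (1 - q) ^+ n.
Proof.
move=> /andP[q0 q1]; elim: n => [|n IH]; first by rewrite mul0r subr0 expr0.
have -> : 1 - n.+1%:R * q = (1 - q) - n%:R * q by rewrite -natr1; ring.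
rewrite exprS; apply: le_trans (ler_wpM2l _ IH); last by rewrite subr_ge0.
have -> : (1 - q) * (1 - n%:R * q) = 1 - q - n%:R * q + n%:R * q ^+ 2 by ring.
by rewrite lerDl mulr_ge0 ?exprn_ge0.
Qed.

Lemma dist_le1 (R : realType) (Y : finType) (p : dist R Y) y : p y <= 1.
Proof.
rewrite -(mass_sum1 p) (bigD1 y) //= lerDl.
by apply: sumr_ge0 => z _; exact: mass_ge0.
Qed.

(** Pigeonhole: if all [m] masses exceeded 1/m, the total would exceed 1. [None] is left out because
    it will be the base response, where g cannot hide. *)
Lemma exists_small_mass (R : realType) (m : nat) (p : dist R (option 'I_m)) :
  (0 < m)%N -> exists i : 'I_m, p (Some i) <= m%:R^-1.
Proof.
move=> m0; case: (pickP (fun i : 'I_m => p (Some i) <= m%:R^-1)) => [i|no_i].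
  by exists i.
suff : 1 < \sum_y p y by rewrite mass_sum1 ltxx.
have le_sum : \sum_(i < m) p (Some i) <= \sum_y p y.
  rewrite (bigD1 None) //= (reindex_onto Some (odflt (Ordinal m0))) /=.
    by under [X in _ + X]eq_bigl => i do rewrite eqxx; rewrite lerDr mass_ge0.
  by case.
apply: lt_le_trans le_sum.
have <- : \sum_(i < m) (m%:R^-1 : R) = 1.
  by rewrite sumr_const card_ord -[_ *+ m]mulr_natr mulVf // pnatr_eq0 -lt0n.
apply: ltr_sum => [|i _]; last by rewrite ltNge no_i.
by apply/hasP; exists (Ordinal m0); rewrite ?mem_index_enum.
Qed.

Lemma relabel_J (R : realType) (X : Type) (Y : finType) (Rmax : R) (s : {perm Y})
    (I : instance X Y Rmax) (pi : policy R X Y) (x : X) :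
  J (relabel s I) (relabel_policy s pi) x = J I pi x.
Proof.
rewrite /J /expect /= (reindex_inj (@perm_inj _ s)) /=.
by under eq_bigr => y _ do rewrite permK.
Qed.

Section Hidden.
Context (R : realType) (X : Type) (Y : finType) (I : instance X Y (1 : R)) (x : X).
Variables (q : R) (a g : Y).
Hypotheses (q01 : 0 <= q <= 1) (neq_ga : g != a).
Hypothesis pi_refE : forall y, pi_ref I x y = two_point_mass q a g y.
Hypothesis r_hatE : forall y, r_hat I x y = (y == g)%:R.
Hypothesis r_starE : forall y, r_star I x y = (y == g)%:R.

(** What is observed when g is never sampled. It does not mention [g], so it is the same wherever g
    hides. *)
Definition base_transcript (n : nat) : transcript R Y n := [ffun=> (a, 1 - q, 0)].

Lemma record_base n : record_queries I x [ffun=> a] = base_transcript n.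
Proof.
apply/ffunP => i; rewrite !ffunE pi_refE r_hatE /two_point_mass eqxx eq_sym.
by rewrite (negbTE neq_ga) mulr1 mulr0 addr0.
Qed.

(** The reward is the probability of outputting [g]: either [g] was sampled, or the algorithm
    guessed it from the base transcript. *)
Lemma J_output_le n (A : algorithm R X Y n) :
  J I (output_policy I A) x <= n%:R * q + A x (base_transcript n) g.
Proof.
rewrite /J /expect /=; under eq_bigr => y _ do rewrite r_starE.
rewrite (sum_indic (output_mass I A x)) /output_mass.
pose w (ys : {ffun 'I_n -> Y}) := \prod_i pi_ref I x (ys i).
have w_ge0 ys : 0 <= w ys by apply: prodr_ge0 => i _; exact: mass_ge0.
have w_base : w [ffun=> a] = (1 - q) ^+ n.
  rewrite /w (eq_bigr (fun=> 1 - q)) ?prodr_const ?card_ord // => i _.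
  by rewrite ffunE pi_refE /two_point_mass eqxx eq_sym (negbTE neq_ga) mulr1
    mulr0 addr0.
have w_sum1 : \sum_ys w ys = 1.
  by rewrite -(bigA_distr_bigA (fun _ => pi_ref I x)) big1 // => i _;
    exact: mass_sum1.
rewrite (bigD1 [ffun=> a]) //= -/(w _) record_base addrC; apply: lerD.
  apply: (@le_trans _ _ (\sum_(ys | ys != [ffun=> a]) w ys)).
    by apply: ler_sum => ys _; apply: ler_piMr; [exact: w_ge0|exact: dist_le1].
  (* The samples other than all-[a] have total weight 1 - (1 - q)^n, at most nq. *)
  have := bernoulli_le n q01.
  by move: w_sum1; rewrite (bigD1 [ffun=> a]) //= w_base; lra.
apply: ler_piMl; first exact: mass_ge0.
by case/andP: q01 => q0 q1; rewrite w_base exprn_ile1 ?subr_ge0 // gerBl.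
Qed.

End Hidden.

(** The response [g] contributes d * d/d^2 = 1, and [a] contributes (1 - d)^2/(1 - d^2) = (1 - d)/(1
    + d) <= 1. Strictness of 0 < d < 1 keeps both denominators nonzero. *)
Lemma coverage_two_point (R : realType) (X : Type) (Y : finType) (Rmax : R)
    (I : instance X Y Rmax) (pi : policy R X Y) (x : X) (d : R) (a g : Y) :
  0 < d < 1 -> g != a ->
  (forall y, pi_ref I x y = two_point_mass (d ^+ 2) a g y) ->
  (forall y, pi x y = two_point_mass d a g y) ->
  (coverage I pi x <= 2%:E)%E.
Proof.
move=> /andP[d0 d1] neq_ga refE piE; have d2 : 0 < d ^+ 2 by rewrite exprn_gt0.
have d21 : d ^+ 2 < 1 by rewrite exprn_ilt1 // ltW.
rewrite /coverage (bigD1 a) //= (bigD1 g) //= big1 => [|y /andP[ya yg]]; last first.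
  by rewrite piE /two_point_mass (negbTE ya) (negbTE yg) !mulr0 addr0 mul0e.
rewrite !piE !refE /two_point_mass !eqxx (negbTE neq_ga) eq_sym (negbTE neq_ga).
rewrite !mulr0 !mulr1 !addr0 !add0r !inver !gt_eqF ?subr_gt0 //.
rewrite -!EFinM -EFinD lee_fin.
have -> : d * (d / d ^+ 2) = 1 by field; rewrite gt_eqF.
suff : (1 - d) * ((1 - d) / (1 - d ^+ 2)) <= 1 by lra.
by rewrite mulrA ler_pdivrMr ?subr_gt0 //; nra.
Qed.

Theorem theorem4p2 (R : realType) (c0 : R) (c0_gt0 : 0 < c0) :
  exists (C c : R) (k l : nat), 0 < C /\ 0 < c /\
  forall (eps : R) (N : nat) (X : Type) (x : X),
    0 < eps -> eps <= 1 / 4 ->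
    (0 < N)%N -> N%:R <= c0 * (1 / eps) ->
  exists (Y : finType) (I : instance X Y (1 : R)) (pi_star : policy R X Y),
    eps_RM I x <= eps /\
    (forall x' : X, coverage I pi_star x' = coverage I pi_star x) /\
    (coverage I pi_star x <= (Otilde_bound C k 1)%:E)%E /\
    forall (n : nat) (A : algorithm R X Y n), (n <= N)%N ->
      (oblivious A ->
        Omegatilde_bound c l (1 / N%:R)
          <= J I pi_star x - J I (output_policy I A) x) /\
      (exists s : {perm Y},
        Omegatilde_bound c l (1 / N%:R)
          <= J (relabel s I) (relabel_policy s pi_star) x
             - J (relabel s I) (output_policy (relabel s I) A) x).
Proof.
exists 2, (1 / 8), 0%N, 0%N; split; first by rewrite ltr0n.
split; first by rewrite divr_gt0 ?ltr0n.
move=> eps N X x eps0 _ N0 _.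
have m0 : (0 < 8 * N)%N by rewrite muln_gt0.
have NR : (1 : R) <= N%:R by rewrite ler1n.
(* This value maximises d - N d^2, the gap before blind guesses of g are counted. *)
pose d : R := (2 * N%:R)^-1.
have dN : d * N%:R = 1 / 2 by rewrite /d; field; rewrite gt_eqF //; lra.
have d01 : 0 < d < 1 by rewrite invr_gt0 invf_lt1; lra.
have d01' : 0 <= d <= 1 by case/andP: d01 => *; rewrite !ltW.
have q01 : 0 <= d ^+ 2 <= 1 by case/andP: d01' => *; rewrite exprn_ge0 ?exprn_ile1.
pose Y := option 'I_(8 * N); pose g : Y := Some (Ordinal m0).
pose r (_ : X) (y : Y) : R := (y == g)%:R.
have r01 x' y : 0 <= r x' y <= 1 by rewrite /r; case: eqP; rewrite ?lexx ler01.
pose I : instance X Y 1 := Instance (fun=> two_point None g q01) r01 r01.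
pose pi_star : policy R X Y := fun=> two_point None g d01'.
exists Y, I, pi_star; split.
  rewrite /eps_RM /expect big1 ?sqrtr0 ?ltW // => y _.
  by rewrite subrr expr0n /= mulr0.
split=> //; split.
  rewrite /Otilde_bound /log_factor expr0 maxxx !mulr1.
  exact: (@coverage_two_point _ _ _ _ _ _ _ d None g).
have J_star : J I pi_star x = d.
  by rewrite /J /expect (sum_indic (pi_star x)) /= /two_point_mass eqxx mulr0
    mulr1 add0r.
move=> n A nN; pose t := base_transcript (d ^+ 2) (None : Y) n.
(* In units of d, sampling g costs at most d/2 and guessing it at most 1/(8N) = d/4, which leaves
   d/4. *)
have gap v p : v <= n%:R * d ^+ 2 + p -> p <= (8 * N)%:R^-1 ->
    Omegatilde_bound (1 / 8) 0 (1 / N%:R) <= d - v.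
  rewrite /Omegatilde_bound /log_factor expr0 maxxx divr1 => le_v le_p.
  have nd : n%:R * d ^+ 2 <= N%:R * d ^+ 2.
    by rewrite ler_wpM2r ?ler_nat //; case/andP: (q01).
  have e1 : N%:R * d ^+ 2 = d / 2 by rewrite expr2 mulrA [N%:R * d]mulrC dN; ring.
  have e2 : (8 * N)%:R^-1 = d / 4 :> R.
    by rewrite /d natrM; field; rewrite gt_eqF //; lra.
  have -> : 1 / 8 * (1 / N%:R) = d / 4 by rewrite /d; field; rewrite gt_eqF //; lra.
  by move: le_v le_p nd; rewrite e1 e2; lra.
have [i small_i] := exists_small_mass (A x t) m0.
split=> [obl|].
  rewrite J_star; apply: (gap _ (A x t g)).
    by apply: (J_output_le (a := None) (g := g) q01).
  (* Every entry of [t] shows [None], so g and [Some i] are both unseen and get equal mass. *)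
  by rewrite (obl x _ g (Some i)) // => j; rewrite ffunE.
(* The swap hides g at the response that [A] rarely guesses from [t]. It fixes [None], so the base
   transcript of the renamed instance is still [t]. *)
exists (tperm g (Some i)); rewrite relabel_J J_star; apply: gap small_i.
have tpE y b : ((tperm g (Some i))^-1%g y == b) = (y == tperm g (Some i) b).
  by rewrite -(inj_eq (@perm_inj _ (tperm g (Some i)))) permKV.
apply: (J_output_le q01) => // y /=; rewrite /two_point_mass /r !tpE ?tpermL //.
by rewrite tpermD.
Qed.
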